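(* Let $f: Vir\times Vir\to Vir$ be a bilinear map. Then $f$ is a biderivation of $Vir$ if and only if $f$ is inner, i.e., there exists a complex number $\lambda$ such that $$f(x,y)=\lambda [x,y]\quad\text{for all } x,y\in Vir.$$
   Context: All vector spaces are over $\mathbb{C}$. The Virasoro algebra $Vir$ is the complex Lie algebra with basis $\{L_m, c \mid m\in\mathbb{Z}\}$ and Lie brackets $$[L_m,L_n]=(m-n)L_{m+n}+\tfrac{m^3-m}{12}\delta_{m+n,0}\,c,\quad [Vir,c]=0$$ for all $m,n\in\mathbb{Z}$. A biderivation of a Lie algebra $L$ is a bilinear map $f:L\times L\to L$ (no skew-symmetry is assumed) satisfying $f([x,y],z)=[x,f(y,z)]+[f(x,z),y]$ and $f(x,[y,z])=[f(x,y),z]+[y,f(x,z)]$ for all $x,y,z\in L$. It is called inner if there is $\lambda\in\mathbb{C}$ with $f(x,y)=\lambda[x,y]$ for all $x,y\in L$. *)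

(* Defs.v *)
From HB Require Import structures.
From mathcomp Require Import all_boot all_order all_algebra ring zify finmap.
From mathcomp Require Import monalg.

Set Implicit Arguments.
Unset Strict Implicit.
Unset Printing Implicit Defensive.

Import GRing.Theory.

Local Open Scope fset_scope.
Local Open Scope ring_scope.

HB.mixin Record Lmodule_isLieAlgebra (K : fieldType) L
    of GRing.Lmodule K L := {
  lie_bracket : L -> L -> L ;
  lie_bracket_bilinear : bilinear_for *:%R *:%R lie_bracket ;
  lie_bracketxx : forall x, lie_bracket x x = 0 ;
  lie_bracket_jacobi : forall x y z,
    lie_bracket x (lie_bracket y z) + lie_bracket y (lie_bracket z x)
      + lie_bracket z (lie_bracket x y) = 0
}.

#[short(type="lieAlgType")]
HB.structure Definition LieAlgebra (K : fieldType) :=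
  { L of GRing.Lmodule K L & Lmodule_isLieAlgebra K L }.

Notation "[ 'lie' x , y ]" := (lie_bracket x y)
  (at level 0, x at level 99, y at level 99, format "[ 'lie'  x ,  y ]")
  : ring_scope.

Section Biderivations.
Context {K : fieldType} {L : lieAlgType K}.

HB.instance Definition _ := @bilinear_isBilinear.Build K L L L *:%R *:%R
  lie_bracket lie_bracket_bilinear.

(* No skew-symmetry of f is required. *)
Definition biderivation (f : {bilinear L -> L -> L}) : Prop :=
  (forall x y z : L, f [lie x, y] z = [lie x, f y z] + [lie f x z, y]) /\
  (forall x y z : L, f x [lie y, z] = [lie f x y, z] + [lie y, f x z]).

Definition inner (f : {bilinear L -> L -> L}) : Prop :=
  exists lambda : K, forall x y : L, f x y = lambda *: [lie x, y].

End Biderivations.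

Section BilinearExtension.
Context {K : fieldType} {I : choiceType} {V : lmodType K}.
Implicit Types (b : I -> I -> V) (x y : {malg K[I]}).

Definition bilinear_ext b x y : V :=
  \sum_(i <- msupp x) \sum_(j <- msupp y) (x@_i * y@_j) *: b i j.

Lemma bilinear_extEw (d e : {fset I}) b x y :
  msupp x `<=` d -> msupp y `<=` e ->
  bilinear_ext b x y = \sum_(i <- d) \sum_(j <- e) (x@_i * y@_j) *: b i j.
Proof.
move=> xd ye; rewrite /bilinear_ext (big_fset_incl _ xd) => [|i _ xi].
  apply: eq_bigr => i _; rewrite (big_fset_incl _ ye) // => j _ yj.
  by rewrite (mcoeff_outdom yj) mulr0 scale0r.
by apply: big1 => j _; rewrite (mcoeff_outdom xi) mul0r scale0r.
Qed.

Lemma bilinear_ext_bilinear b : bilinear_for *:%R *:%R (bilinear_ext b).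
Proof.
split=> [y a x x' | x a y y'].
- set d := (msupp x `|` msupp x' `|` msupp (a *: x + x'))%fset.
  rewrite !(@bilinear_extEw d (msupp y)) //= /d.
  + rewrite scaler_sumr -big_split; apply: eq_bigr => i _ /=.
    rewrite scaler_sumr -big_split; apply: eq_bigr => j _ /=.
    by rewrite mcoeffD mcoeffZ mulrDl scalerDl scalerA mulrA.
  + by apply/fsubsetP => i; rewrite !inE => ->; rewrite orbT.
  + by apply/fsubsetP => i; rewrite !inE => ->.
  + by apply/fsubsetP => i; rewrite !inE => ->; rewrite orbT.
- set d := (msupp y `|` msupp y' `|` msupp (a *: y + y'))%fset.
  rewrite !(@bilinear_extEw (msupp x) d) //= /d.
  + rewrite scaler_sumr -big_split; apply: eq_bigr => i _ /=.
    rewrite scaler_sumr -big_split; apply: eq_bigr => j _ /=.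
    by rewrite mcoeffD mcoeffZ mulrDr scalerDl scalerA mulrCA.
  + by apply/fsubsetP => i; rewrite !inE => ->; rewrite orbT.
  + by apply/fsubsetP => i; rewrite !inE => ->.
  + by apply/fsubsetP => i; rewrite !inE => ->; rewrite orbT.
Qed.

Lemma bilinear_extUU b i j : bilinear_ext b << i >> << j >> = b i j.
Proof.
rewrite /bilinear_ext !msuppU oner_eq0 !big_seq_fset1.
by rewrite !mcoeffUU mulr1 scale1r.
Qed.

End BilinearExtension.

Lemma scalerDl3 (K : fieldType) (V : lmodType K) (a b a' b' a'' b'' : K)
    (u v : V) :
  (a *: u + b *: v) + (a' *: u + b' *: v) + (a'' *: u + b'' *: v) =
  (a + a' + a'') *: u + (b + b' + b'') *: v.
Proof. by rewrite !scalerDl [LHS](AC ((2*2)*2) ((1*3*5)*(2*4*6))). Qed.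

(* The Lie algebra axioms only have to be checked on a spanning family. *)
Section LieFromSpan.
Context {K : fieldType} {V : lmodType K} {I : Type}.
Variables (br : V -> V -> V) (e : I -> V).
Hypothesis br_bilinear : bilinear_for *:%R *:%R br.
Hypothesis e_ind : forall P : V -> Prop,
  P 0 -> (forall a x y, P x -> P y -> P (a *: x + y)) ->
  (forall i, P (e i)) -> forall x, P x.

Let brPl a x y z : br (a *: x + y) z = a *: br x z + br y z.
Proof. exact: br_bilinear.1. Qed.

Let brPr a x y z : br x (a *: y + z) = a *: br x y + br x z.
Proof. exact: br_bilinear.2. Qed.

Lemma bilinear_for0l x : br 0 x = 0.
Proof. by rewrite -[in LHS](addNr 0) -scaleN1r brPl scaleN1r addNr. Qed.

Lemma bilinear_for0r x : br x 0 = 0.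
Proof. by rewrite -[in LHS](addNr 0) -scaleN1r brPr scaleN1r addNr. Qed.

Lemma skew_span : (forall i j, br (e i) (e j) + br (e j) (e i) = 0) ->
  forall x y, br x y + br y x = 0.
Proof.
move=> eC x y; elim/e_ind: x => [|a x x' xy x'y|i].
- by rewrite bilinear_for0l bilinear_for0r addr0.
- by rewrite brPl brPr addrACA -scalerDr xy x'y scaler0 addr0.
elim/e_ind: y => [|a y y' my my'|j] //.
- by rewrite bilinear_for0l bilinear_for0r addr0.
- by rewrite brPl brPr addrACA -scalerDr my my' scaler0 addr0.
Qed.

Lemma alternating_span : (forall i j, br (e i) (e j) + br (e j) (e i) = 0) ->
  (forall i, br (e i) (e i) = 0) -> forall x, br x x = 0.
Proof.
move=> eC exx; elim/e_ind => [|a x y xx yy|//]; first exact: bilinear_for0l.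
rewrite brPl !brPr xx yy scaler0 add0r addr0 -scalerDr.
by rewrite skew_span // scaler0.
Qed.

Lemma jacobi_span :
  (forall i j k, br (e i) (br (e j) (e k)) + br (e j) (br (e k) (e i))
     + br (e k) (br (e i) (e j)) = 0) ->
  forall x y z, br x (br y z) + br y (br z x) + br z (br x y) = 0.
Proof.
pose J x y z := br x (br y z) + br y (br z x) + br z (br x y).
move=> eJ x y z; rewrite -/(J x y z).
have Jrot u v w : J u v w = J w u v by rewrite /J addrC addrA.
have J0 v w : J 0 v w = 0 by rewrite /J !(bilinear_for0l, bilinear_for0r) !addr0.
have JP a u u' v w : J u v w = 0 -> J u' v w = 0 -> J (a *: u + u') v w = 0.
  move=> Ju Ju'; transitivity (a *: J u v w + J u' v w).
    rewrite /J !(brPl, brPr) !scalerDr.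
    by rewrite [LHS](AC ((2*2)*2) ((1*3*5)*(2*4*6))).
  by rewrite Ju Ju' scaler0 addr0.
elim/e_ind: x => [|a x x' xP x'P|i] //; first exact: JP.
rewrite Jrot; elim/e_ind: z => [|a z z' zP z'P|k] //; first exact: JP.
rewrite Jrot; elim/e_ind: y => [|a y y' yP y'P|j] //; first exact: JP.
exact: eJ.
Qed.

End LieFromSpan.

Section Virasoro.
Variable K : fieldType.

(* Finitely supported functions on the basis: [Some m] indexes L_m and [None]
   indexes the central element c. *)
Definition vir : Type := {malg K[option int]}.

HB.instance Definition _ := GRing.Lmodule.on vir.

Definition vir_basis (i : option int) : vir := << i >>.

Local Notation vir_L m := (vir_basis (Some m)).
Local Notation vir_c := (vir_basis None).

Definition vir_basis_bracket (i j : option int) : vir :=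
  match i, j with
  | Some m, Some n =>
      (m - n)%:~R *: vir_L (m + n)
      + (if m + n == 0 then (m ^+ 3 - m)%:~R / 12%:R else 0) *: vir_c
  | _, _ => 0
  end.

Definition vir_bracket : vir -> vir -> vir := bilinear_ext vir_basis_bracket.

Lemma vir_bracket_bilinear : bilinear_for *:%R *:%R vir_bracket.
Proof. exact: bilinear_ext_bilinear. Qed.

Lemma vir_bracketLL m n : vir_bracket (vir_L m) (vir_L n) =
  (m - n)%:~R *: vir_L (m + n)
  + (if m + n == 0 then (m ^+ 3 - m)%:~R / 12%:R else 0) *: vir_c.
Proof. exact: bilinear_extUU. Qed.

Lemma vir_bracketcl x : vir_bracket vir_c x = 0.
Proof.
rewrite /vir_bracket /bilinear_ext msuppU oner_eq0 big_seq_fset1.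
by apply: big1 => j _; rewrite scaler0.
Qed.

Lemma vir_bracketlc x : vir_bracket x vir_c = 0.
Proof.
rewrite /vir_bracket /bilinear_ext msuppU oner_eq0.
by apply: big1 => -[m|] _; rewrite big_seq_fset1 scaler0.
Qed.

Lemma vir_basis_ind (P : vir -> Prop) :
  P 0 -> (forall a x y, P x -> P y -> P (a *: x + y)) ->
  (forall i, P (vir_basis i)) -> forall x, P x.
Proof.
move=> P0 PP Pe x; rewrite [x]monalgE; elim/big_rec: _ => // k y _ Py.
have -> : << x@_k *g k >> = x@_k *: << k >> :> {malg K[option int]}.
  by apply/malgP => j; rewrite mcoeffZ !mcoeffU mulr_natr.
exact: PP (Pe k) Py.
Qed.

Lemma vir_bracket_basisC i j : vir_bracket (vir_basis i) (vir_basis j)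
  + vir_bracket (vir_basis j) (vir_basis i) = 0.
Proof.
case: i j => [m|] [n|]; rewrite ?(vir_bracketcl, vir_bracketlc) ?addr0 //.
rewrite !vir_bracketLL [n + m]addrC addrACA -!scalerDl.
have -> : (m - n)%:~R + (n - m)%:~R = 0 :> K by ring.
case: eqP => [/eqP|_]; last by rewrite addr0 !scale0r addr0.
rewrite addr_eq0 => /eqP ->.
have -> : ((- n) ^+ 3 - - n)%:~R / 12%:R + (n ^+ 3 - n)%:~R / 12%:R = 0 :> K.
  by ring.
by rewrite !scale0r addr0.
Qed.

Lemma vir_bracketxx x : vir_bracket x x = 0.
Proof.
apply: (alternating_span vir_bracket_bilinear vir_basis_ind vir_bracket_basisC).
case=> [m|]; last exact: vir_bracketcl.
rewrite vir_bracketLL subrr scale0r add0r.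
case: eqP => [m0|_]; last by rewrite scale0r.
have -> : m = 0 by move: m0; lia.
by rewrite expr0n subrr mul0r scale0r.
Qed.

Lemma vir_bracketLLL i j k :
  vir_bracket (vir_L i) (vir_bracket (vir_L j) (vir_L k)) =
    ((j - k) * (i - (j + k)))%:~R *: vir_L (i + (j + k))
    + (if i + (j + k) == 0
       then ((j - k) * (i ^+ 3 - i))%:~R / 12%:R else 0) *: vir_c.
Proof.
have brP a (x y : vir) : vir_bracket (vir_L i) (a *: x + y) =
    a *: vir_bracket (vir_L i) x + vir_bracket (vir_L i) y.
  exact: vir_bracket_bilinear.2.
have brZc a : vir_bracket (vir_L i) (a *: vir_c) = 0.
  rewrite -[X in vir_bracket _ X]addr0 brP vir_bracketlc scaler0 add0r.
  exact: bilinear_for0r vir_bracket_bilinear _.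
rewrite (vir_bracketLL j k) brP brZc.
rewrite addr0 vir_bracketLL scalerDr !scalerA -intrM.
by case: ifP => _; rewrite ?mulr0 // mulrA -intrM.
Qed.

Lemma vir_bracket_jacobi x y z :
  vir_bracket x (vir_bracket y z) + vir_bracket y (vir_bracket z x)
    + vir_bracket z (vir_bracket x y) = 0.
Proof.
move: x y z; apply: (jacobi_span vir_bracket_bilinear vir_basis_ind).
have br0 := bilinear_for0r vir_bracket_bilinear.
case=> [l|] [m|] [n|];
  rewrite ?(vir_bracketcl, vir_bracketlc) ?br0 ?addr0 //.
rewrite !vir_bracketLLL.
have -> : m + (n + l) = l + (m + n) by ring.
have -> : n + (l + m) = l + (m + n) by ring.
rewrite [LHS]scalerDl3.
set a := (X in X *: _ + _); have -> : a = 0 by rewrite /a; ring.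
case: eqP => [/eqP|_]; last by rewrite !addr0 !scale0r addr0.
rewrite addr_eq0 => /eqP ->.
set b := (X in _ + X *: _); have -> : b = 0 by rewrite /b; ring.
by rewrite !scale0r addr0.
Qed.

HB.instance Definition _ := Lmodule_isLieAlgebra.Build K vir
  vir_bracket_bilinear vir_bracketxx vir_bracket_jacobi.

Lemma vir_lieLL m n : [lie vir_L m, vir_L n] =
  (m - n)%:~R *: vir_L (m + n)
  + (if m + n == 0 then (m ^+ 3 - m)%:~R / 12%:R else 0) *: vir_c.
Proof. exact: vir_bracketLL. Qed.

Lemma vir_lie_cl (x : vir) : [lie vir_c, x] = 0.
Proof. exact: vir_bracketcl. Qed.

End Virasoro.

(* Main.v *)
Require Import Defs.
From mathcomp Require Import all_boot all_algebra complex reals.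
From HB Require Import structures.
From mathcomp Require Import ring zify monalg.

(** An inner map is a biderivation by the Jacobi identity
    ([inner_biderivation]).  For the converse, the center of Vir is the line
    spanned by c, and a biderivation sends a central argument to a central
    value ([biderivation_centrall], [biderivation_centralr]).  Modulo the
    center, f is therefore determined by its values on the Witt algebra
    Vir / Cc, and these split according to degree: the coefficients
    p_d(m, n) of L_(m+n+d) in f(L_m, L_n) satisfy, for each d separately, two
    scalar identities, the derivation rules in either argument.

    The instances of these identities in which L_0 is bracketed express
    p_d(m, n) through p_d(0, n) or through p_d(m, 0), outside a few indices.
    For d <> 0 this leads to p_d = 0 ([component_nonzero_degree]); for d = 0
    it leads to p_0(m, n) = a (m - n) with a = p_0(1, 0)
    ([component_degree0]).  Hence f(x, y) - a [x, y] is always central.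

    A central error is invisible inside a bracket, so the derivation rule
    gives f([x, y], z) = a [[x, y], z] exactly ([biderivation_bracketl]);
    since Vir is perfect ([vir_lie_ind]), f = a [., .]. *)

Set Implicit Arguments.
Unset Strict Implicit.
Unset Printing Implicit Defensive.

Import GRing.Theory Num.Theory.

Local Open Scope ring_scope.

(** * Biderivations and the center of a Lie algebra *)

Section LieAlgebra.
Variables (K : fieldType) (L : lieAlgType K).
Implicit Types x y z : L.

Lemma lie_skew x y : [lie x, y] = - [lie y, x].
Proof.
apply/eqP; rewrite -addr_eq0; apply/eqP.
have := lie_bracketxx (x + y); rewrite linearDl !linearDr /=.
by rewrite !lie_bracketxx add0r addr0.
Qed.

Lemma lie_leibniz x y z :
  [lie x, [lie y, z]] = [lie [lie x, y], z] + [lie y, [lie x, z]].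
Proof.
apply/eqP; rewrite -subr_eq0; apply/eqP.
rewrite -[RHS](lie_bracket_jacobi x y z).
rewrite (lie_skew z x) (lie_skew z [lie x, y]) linearNr /=.
by rewrite opprD addrA addrAC.
Qed.

Lemma lie_leibnizl x y z :
  [lie [lie x, y], z] = [lie x, [lie y, z]] + [lie [lie x, z], y].
Proof. by rewrite (lie_leibniz x y z) (lie_skew [lie x, z]) addrK. Qed.

Lemma inner_biderivation (f : {bilinear L -> L -> L}) :
  inner f -> biderivation f.
Proof.
case=> a fE; split=> x y z; rewrite !fE !(linearZl_LR, linearZr) /= -scalerDr.
  by rewrite -lie_leibnizl.
by rewrite -lie_leibniz.
Qed.

Definition central x : Prop := forall y, [lie y, x] = 0.

(** In the derivation rule for f([y, x], z) with x central, the left side and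
    the term [f(y, z), x] vanish, which leaves [y, f(x, z)] = 0. *)
Lemma biderivation_centrall (f : {bilinear L -> L -> L}) x z :
  biderivation f -> central x -> central (f x z).
Proof.
by case=> fl _ xC y; have := fl y x z; rewrite !xC linear0l addr0 => ->.
Qed.

Lemma biderivation_centralr (f : {bilinear L -> L -> L}) x z :
  biderivation f -> central x -> central (f z x).
Proof.
by case=> _ fr xC y; have := fr z y x; rewrite !xC linear0r add0r => ->.
Qed.

Lemma central0 : central 0.
Proof. by move=> y; rewrite linear0r. Qed.

Lemma centralP (b : K) x y : central x -> central y -> central (b *: x + y).
Proof. by move=> xC yC z; rewrite linearPr /= xC yC scaler0 addr0. Qed.

Definition defect (f : {bilinear L -> L -> L}) (a : K) x y : L :=
  f x y - a *: [lie x, y].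

Lemma defectPl f a b x x' y :
  defect f a (b *: x + x') y = b *: defect f a x y + defect f a x' y.
Proof.
rewrite /defect !linearPl /= scalerBr !scalerDr opprD !scalerA (mulrC a b).
by rewrite addrACA.
Qed.

Lemma defectPr f a b x y y' :
  defect f a x (b *: y + y') = b *: defect f a x y + defect f a x y'.
Proof.
rewrite /defect !linearPr /= scalerBr !scalerDr opprD !scalerA (mulrC a b).
by rewrite addrACA.
Qed.

(** The derivation rule writes f([x, y], z) as a sum of brackets of values of
    f, and a bracket does not see a central error in its arguments.  So a map
    that is inner modulo the center is inner on the derived algebra. *)
Lemma biderivation_bracketl (f : {bilinear L -> L -> L}) (a : K) x y z :
  biderivation f -> (forall u v, central (defect f a u v)) ->
  f [lie x, y] z = a *: [lie [lie x, y], z].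
Proof.
case=> fl _ fC.
have fE u v w : [lie w, f u v] = a *: [lie w, [lie u, v]].
  by apply/eqP; rewrite -subr_eq0 -(fC u v w) /defect linearBr linearZr.
rewrite fl fE (lie_skew (f x z)) fE -scalerN -scalerDr.
by rewrite -lie_skew -lie_leibnizl.
Qed.

End LieAlgebra.

(** * The scalar equations of a homogeneous component *)

(** Reduces a linear consequence of an equation to a ring identity. *)
Lemma eq_from_sub (V : zmodType) (a b c d : V) :
  a = b -> c - d = a - b -> c = d.
Proof. by move=> ->; rewrite subrr => /eqP; rewrite subr_eq0 => /eqP. Qed.

Section DegreeComponent.
Variable K : numFieldType.

Lemma mulr_intI (n : int) (a b : K) :
  n != 0 -> n%:~R * a = n%:~R * b -> a = b.
Proof. by move=> n0; apply: mulfI; rewrite intr_eq0. Qed.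

Variables (d : int) (p : int -> int -> K).
(* The derivation rules for the map (L_m, L_n) |-> p m n L_(m+n+d) on the Witt
   algebra. *)
Hypothesis pDl : forall l m n, (l - m)%:~R * p (l + m) n =
  (l - m - n - d)%:~R * p m n + (l + n + d - m)%:~R * p l n.
Hypothesis pDr : forall l m n, (m - n)%:~R * p l (m + n) =
  (l + d + m - n)%:~R * p l m + (m - l - n - d)%:~R * p l n.

(* Bracketing with L_0 is diagonal, so it turns the rules into recursions. *)
Let p0l m n : (n + d)%:~R * p m n = (n + d - m)%:~R * p 0 n.
Proof.
by have := pDl 0 m n; rewrite (add0r m) => e; apply: (eq_from_sub e); ring.
Qed.

Let p0r m n : (m + d)%:~R * p m n = (m + d - n)%:~R * p m 0.
Proof.
by have := pDr m 0 n; rewrite (add0r n) => e; apply: (eq_from_sub e); ring.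
Qed.

(** The recursions express p through p 0 0, and they contradict each other at
    p 0 (- d) unless p 0 0 = 0.  Their leading coefficients m + d and n + d
    vanish simultaneously only at (- d, - d), where the value has to be read
    off a different instance of the derivation rule. *)
Lemma component_nonzero_degree m n : d != 0 -> p m n = 0.
Proof.
move=> d0.
have p00 : p 0 0 = 0.
  have p0d : p 0 (- d) = 0.
    apply: (@mulr_intI d) => //.
    by have /esym e := p0l (- d) (- d); apply: (eq_from_sub e); ring.
  apply: (@mulr_intI (2 * d)); first by lia.
  have /esym e := p0r 0 (- d); rewrite p0d in e.
  by apply: (eq_from_sub e); ring.
have p0n k : p 0 k = 0.
  apply: (@mulr_intI d) => //.
  by have := p0r 0 k; rewrite p00 => e; apply: (eq_from_sub e); ring.
have pn0 k : p k 0 = 0.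
  apply: (@mulr_intI d) => //.
  by have := p0l k 0; rewrite p00 => e; apply: (eq_from_sub e); ring.
have pr i j : j != - d -> p i j = 0.
  move=> jd; apply: (@mulr_intI (j + d)); first by lia.
  by rewrite p0l p0n !mulr0.
have [->|/pr//] := eqVneq n (- d).
have [->|md] := eqVneq m (- d); last first.
  apply: (@mulr_intI (m + d)); first by lia.
  by rewrite p0r pn0 !mulr0.
(* L_(-d) is, up to the factor -3d, the bracket of L_(-2d) and L_d, at which
   p (- d) is already known to vanish. *)
apply: (@mulr_intI (- (3 * d))); first by lia.
have := pDr (- d) (- d - d) d.
rewrite subrK (pr _ (- d - d)) ?(pr _ d); [|by lia|by lia].
by move=> e; apply: (eq_from_sub e); ring.
Qed.

(** Solving the recursions from p i j back to p 0 j or p i 0 fails at i = j,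
    so starting from p 1 0 a few exceptional indices remain; they are reached
    by a detour through another index. *)
Lemma component_degree0 m n : d = 0 -> p m n = p 1 0 * (m - n)%:~R.
Proof.
move=> d0; have q0l i j : j%:~R * p i j = (j - i)%:~R * p 0 j.
  by have := p0l i j; rewrite d0 !addr0.
have q0r i j : i%:~R * p i j = (i - j)%:~R * p i 0.
  by have := p0r i j; rewrite d0 !addr0.
set a := p 1 0.
have p1 j : p 1 j = a * (1 - j)%:~R.
  by have := q0r 1 j; rewrite -/a => e; apply: (eq_from_sub e); ring.
have p0n' j : j != 1 -> p 0 j = - (a * j%:~R).
  move=> j1; apply: (@mulr_intI (j - 1)); first by lia.
  by have /esym := q0l 1 j; rewrite p1 => e; apply: (eq_from_sub e); ring.
have pn' i j : j != 0 -> j != 1 -> p i j = a * (i - j)%:~R.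
  move=> j0 j1; apply: (@mulr_intI j) => //.
  by rewrite q0l p0n' //; ring.
have pn0 i : i != 0 -> i != 2 -> p i 0 = a * i%:~R.
  move=> i0 i2; apply: (@mulr_intI (i - 2)); first by lia.
  have /esym := q0r i 2; rewrite (pn' i 2) // => e.
  by apply: (eq_from_sub e); ring.
(* Both recursions evaluate p (-1) 1, one through p 0 1. *)
have p01 : p 0 1 = - a.
  apply: (@mulr_intI 2) => //; have := q0l (-1) 1; have := q0r (-1) 1.
  rewrite pn0 // => e1 e2.
  by apply: (eq_from_sub (esym (congr2 +%R e1 e2))); ring.
have p0n j : p 0 j = - (a * j%:~R).
  by have [->|/p0n'//] := eqVneq j 1; rewrite p01; ring.
have pn i j : j != 0 -> p i j = a * (i - j)%:~R.
  by move=> j0; apply: (@mulr_intI j) => //; rewrite q0l p0n; ring.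
have [->|/pn//] := eqVneq n 0.
have [->|m0] := eqVneq m 0; first by rewrite p0n; ring.
apply: (@mulr_intI (m + m)); first by lia.
have /esym := q0r m (- m); rewrite (pn m (- m)) ?oppr_eq0 // => e.
by apply: (eq_from_sub e); ring.
Qed.

End DegreeComponent.

(** * The Virasoro algebra *)

Section Virasoro.
Variable K : numFieldType.
Implicit Types x y z : vir K.

Local Notation vir_L m := (vir_basis K (Some m)).
Local Notation vir_c := (vir_basis K None).

Definition coefL (k : int) x : K := mcoeff (Some k) x.

Lemma coefL_is_linear k : scalar (coefL k).
Proof. by move=> a x y; rewrite /coefL mcoeffD mcoeffZ. Qed.

HB.instance Definition _ k := GRing.isLinear.Build K (vir K) K *%R
  (coefL k) (coefL_is_linear k).

Lemma coefLL k m : coefL k (vir_L m) = (m == k)%:R.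
Proof. exact: mcoeffU. Qed.

Lemma coefLc k : coefL k vir_c = 0.
Proof. exact: mcoeffU. Qed.

Lemma coefL_lie l k x :
  coefL k [lie vir_L l, x] = (l + l - k)%:~R * coefL (k - l) x.
Proof.
elim/vir_basis_ind: x => [|a x y IHx IHy|[m|]].
- by rewrite linear0r !linear0 mulr0.
- by rewrite linearPr /= !linearP /= IHx IHy; ring.
- rewrite vir_lieLL !linearP linearZ /= !coefLL coefLc mulr0 addr0.
  have -> : (l + m == k) = (m == k - l) by lia.
  have [->|] := eqVneq m (k - l); rewrite ?mulr0 //.
  by congr (_%:~R * _); ring.
by rewrite lie_skew vir_lie_cl oppr0 linear0 coefLc mulr0.
Qed.

(** The shape of the right-hand sides of the two derivation rules. *)
Lemma coefL_lieD k l m x y :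
  coefL k ([lie vir_L l, x] + [lie y, vir_L m]) =
    (l + l - k)%:~R * coefL (k - l) x + (k - m - m)%:~R * coefL (k - m) y.
Proof. by rewrite linearD (lie_skew y) linearN /= !coefL_lie; ring. Qed.

Lemma vir_c_central : central vir_c.
Proof. by move=> x; rewrite lie_skew vir_lie_cl oppr0. Qed.

(** The functions coefL k describe Vir modulo its center. *)
Lemma coefL_central x : central x <-> forall k, coefL k x = 0.
Proof.
split=> [xC k|x0].
  (* [L_(k+1), L_k] = L_(2k+1) up to c, so bracketing with L_(k+1) detects the
     coefficient of L_k. *)
  have := coefL_lie (k + 1) (k + 1 + k) x.
  rewrite xC linear0; have -> : k + 1 + k - (k + 1) = k by ring.
  by move=> /esym e; apply: (eq_from_sub e); ring.
suff -> : x = mcoeff None x *: vir_c.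
  by move=> y; rewrite linearZr /= vir_c_central scaler0.
apply/malgP => -[k|]; rewrite mcoeffZ mcoeffU /= ?mulr1 ?mulr0 //.
exact: x0.
Qed.

(** Perfectness of Vir, as an induction principle: L_m is a multiple of
    [L_0, L_m] for m <> 0, L_0 of [L_1, L_(-1)], and
    [L_2, L_(-2)] = 4 L_0 + c / 2 yields c. *)
Lemma vir_lie_ind (P : vir K -> Prop) :
  (forall a x y, P x -> P y -> P (a *: x + y)) ->
  (forall x y, P [lie x, y]) -> forall x, P x.
Proof.
move=> PP Pl.
have P0 : P 0 by have := Pl 0 0; rewrite linear0r.
have PZ a x : P x -> P (a *: x).
  by move=> Px; rewrite -[a *: x]addr0; apply: PP.
have PL m : P (vir_L m).
  have [->|m0] := eqVneq m 0.
    have := PZ 2^-1 _ (Pl (vir_L 1) (vir_L (-1))).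
    (* subrr also cancels the cocycle 1 ^+ 3 - 1. *)
    rewrite vir_lieLL subrr eqxx mul0r scale0r addr0 scalerA.
    by rewrite opprK mulVf ?scale1r // pnatr_eq0.
  have := PZ (- m%:~R)^-1 _ (Pl (vir_L 0) (vir_L m)).
  rewrite vir_lieLL !add0r (negPf m0) scale0r addr0 scalerA intrN.
  by rewrite mulVf ?scale1r // oppr_eq0 intr_eq0.
apply: (vir_basis_ind P0 PP) => -[m|]; first exact: PL.
have := PZ 2 _ (PP (- 4) _ _ (PL 0) (Pl (vir_L 2) (vir_L (- 2)))).
rewrite vir_lieLL subrr eqxx addrA -scalerDl.
have -> : - 4 + (2 - - 2 : int)%:~R = 0 :> K by ring.
rewrite scale0r add0r scalerA.
have -> : 2 * (((2 : int) ^+ 3 - 2)%:~R / 12%:R) = 1 :> K by field.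
by rewrite scale1r.
Qed.

Lemma biderivation_inner (f : {bilinear vir K -> vir K -> vir K}) :
  biderivation f -> inner f.
Proof.
move=> fB; have [fl fr] := fB.
have fcl k x : coefL k (f vir_c x) = 0.
  by move: k; apply/coefL_central/biderivation_centrall/vir_c_central.
have fcr k x : coefL k (f x vir_c) = 0.
  by move: k; apply/coefL_central/biderivation_centralr/vir_c_central.
(* The central part of [L_l, L_m] contributes only a central value of f. *)
have fLl k l m z : coefL k (f [lie vir_L l, vir_L m] z) =
    (l - m)%:~R * coefL k (f (vir_L (l + m)) z).
  rewrite vir_lieLL; move: (if _ then _ else _) => b.
  by rewrite (linearPl f) linearP (linearZl_LR f) linearZ /= fcl mulr0 addr0.
have fLr k l m z : coefL k (f z [lie vir_L l, vir_L m]) =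
    (l - m)%:~R * coefL k (f z (vir_L (l + m))).
  rewrite vir_lieLL; move: (if _ then _ else _) => b.
  by rewrite (linearPr f) linearP (linearZr_LR f) linearZ /= fcr mulr0 addr0.
pose p d m n := coefL (m + n + d) (f (vir_L m) (vir_L n)).
have pDl d l m n : (l - m)%:~R * p d (l + m) n =
    (l - m - n - d)%:~R * p d m n + (l + n + d - m)%:~R * p d l n.
  rewrite /p -fLl fl coefL_lieD.
  have -> : l + m + n + d - l = m + n + d by ring.
  have -> : l + m + n + d - m = l + n + d by ring.
  by congr (_%:~R * _ + _%:~R * _); ring.
have pDr d l m n : (m - n)%:~R * p d l (m + n) =
    (l + d + m - n)%:~R * p d l m + (m - l - n - d)%:~R * p d l n.
  rewrite /p -fLr fr [X in coefL _ X]addrC coefL_lieD [RHS]addrC.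
  have -> : l + (m + n) + d - n = l + m + d by ring.
  have -> : l + (m + n) + d - m = l + n + d by ring.
  by congr (_%:~R * _ + _%:~R * _); ring.
set a := p 0 1 0.
have fLC m n : central (defect f a (vir_L m) (vir_L n)).
  apply/coefL_central => k.
  rewrite linearB linearZ /= vir_lieLL linearP linearZ /= coefLL coefLc.
  rewrite mulr0 addr0.
  have -> : coefL k (f (vir_L m) (vir_L n)) = p (k - (m + n)) m n.
    by rewrite /p addrC subrK.
  have [mnk|mnk] := eqVneq (m + n) k.
    rewrite mnk subrr (component_degree0 (pDl 0) (pDr 0)) //.
    by rewrite mulr1 subrr.
  rewrite (component_nonzero_degree (pDl _) (pDr _)) ?mulr0 ?subrr //.
  by lia.
have fC x y : central (defect f a x y).
  elim/vir_basis_ind: x => [|b x x' xP x'P|[m|]].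
  - by rewrite /defect !linear0l scaler0 subr0; apply: central0.
  - by rewrite defectPl; apply: centralP.
  - elim/vir_basis_ind: y => [|b y y' yP y'P|[n|]].
    + by rewrite /defect !linear0r scaler0 subr0; apply: central0.
    + by rewrite defectPr; apply: centralP.
    + exact: fLC.
    + rewrite /defect vir_c_central scaler0 subr0.
      exact: biderivation_centralr vir_c_central.
  rewrite /defect vir_lie_cl scaler0 subr0.
  exact: biderivation_centrall vir_c_central.
exists a => x y; elim/vir_lie_ind: x => [b x x' xP x'P|x x'].
  by rewrite !linearPl /= xP x'P scalerDr !scalerA mulrC.
exact: biderivation_bracketl.
Qed.

End Virasoro.

Local Open Scope complex_scope.

Theorem theorem3p1 (R : realType)
  (f : {bilinear vir R[i] -> vir R[i] -> vir R[i]}) :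
  biderivation f <-> inner f.
Proof. by split; [exact: biderivation_inner | exact: inner_biderivation]. Qed.
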